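(* Let $H_\alpha(k)$, $k\in\mathbb T^d$, be the fiber magnetic Schrödinger operator on the fundamental graph $\mathcal G_*=(\mathcal V_*,\mathcal A_* )$ (see context), and let $\tau_+=\max_{\mathbf e\in\mathcal A_*}\|\tau(\mathbf e)\|$ (Euclidean norm). Then for each $n\in\mathbb N$: (i) $\displaystyle \operatorname{Tr}H_\alpha^n(k)=\sum_{j=1}^{\nu}\lambda_{\alpha,j}^n(k)=\mathcal T_{\alpha,n}(k)$, where $$\mathcal T_{\alpha,n}(k)=\sum_{\mathbf c\in\widetilde{\mathcal C}_n}\omega(\mathbf c)e^{-i\phi(\mathbf c,k)}=\sum_{\mathbf c\in\widetilde{\mathcal C}_n}\omega(\mathbf c)\cos\phi(\mathbf c,k),\qquad \phi(\mathbf c,k)=\alpha(\mathbf c)+\langle\tau(\mathbf c),k\rangle,$$ or, in the form of a Fourier series, $$\mathcal T_{\alpha,n}(k)=\sum_{\mathrm m\in\mathbb Z^d,\ \|\mathrm m\|\le n\tau_+}\mathcal T_{\alpha,n,\mathrm m}e^{-i\langle\mathrm m,k\rangle},\qquad \mathcal T_{\alpha,n,\mathrm m}=\sum_{\mathbf c\in\widetilde{\mathcal C}_n^{\mathrm m}}\omega(\mathbf c)e^{-i\alpha(\mathbf c)}.$$ (ii) $\displaystyle \frac1{(2\pi)^d}\int_{\mathbb T^d}\operatorname{Tr}H_\alpha^n(k)\,dk=\mathcal T_{\alpha,n,0}$, where $\displaystyle\mathcal T_{\alpha,n,0}=\sum_{\mathbf c\in\widetilde{\mathcal C}_n^0}\omega(\mathbf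 c)e^{-i\alpha(\mathbf c)}=\sum_{\mathbf c\in\widetilde{\mathcal C}_n^0}\omega(\mathbf c)\cos\alpha(\mathbf c)$.
   Context: Let $\Gamma\subset\mathbb R^d$ be a lattice with basis $\mathfrak a_1,\dots,\mathfrak a_d$ and fundamental cell $\Omega=\{\sum_s x_s\mathfrak a_s:(x_s)\in[0,1)^d\}$. Let $\mathcal G=(\mathcal V,\mathcal E)$ be a connected, locally finite, infinite graph embedded in $\mathbb R^d$ (loops and multiple edges allowed), invariant under translations by $\Gamma$, whose quotient $\mathcal G_*=\mathcal G/\Gamma=(\mathcal V_*,\mathcal E_* )$ (fundamental graph) is finite; $\nu=\#\mathcal V_*$. Each unoriented edge gives two oriented edges; $\mathcal A$, $\mathcal A_*=\mathcal A/\Gamma$ are the sets of oriented edges of $\mathcal G,\mathcal G_*$; $(x,y)$ is an oriented edge from $x$ to $y$ and $\underline{\mathbf e}$ the inverse of $\mathbf e$. The degree $\varkappa_x$ is the number of oriented edges starting at $x$ (loops counted twice). Edge index: each $x\in\mathcal V$ is uniquely $x=x_0+[x]$ with $x_0\in\mathcal V\cap\Omega$, $[x]\in\Gamma$; let $[x]_{\mathbb A}\in\mathbb Z^d$ be the coordinates of $[x]$ in the basis $(\mathfrak a_s)$; for $\mathbf e=(x,y)\in\mathcal A$, $\tau(\mathbf e)=[y]_{\mathbb A}-[x]_{\mathbb A}\in\mathbb Z^d$; this is $\Gamma$-invariant and so defines $\tau$ on $\mathcal A_*$, with $\tau(\underline{\mathbf e})=-\tau(\mathbf e)$. A periodic magnetic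 potential is $\alpha:\mathcal A\to\mathbb R$ with $\alpha(\underline{\mathbf e})=-\alpha(\mathbf e)$ and $\alpha(\mathbf e+\gamma)=\alpha(\mathbf e)$ for $\gamma\in\Gamma$ (hence defined on $\mathcal A_*$); a periodic electric potential is a $\Gamma$-periodic $V:\mathcal V\to\mathbb R$ (regarded as a function on $\mathcal V_*$). For $k\in\mathbb T^d=\mathbb R^d/(2\pi\mathbb Z)^d$, the fiber operator on $\ell^2(\mathcal V_* )=\mathbb C^\nu$ is $H_\alpha(k)=-\Delta_\alpha(k)+V$, $\Delta_\alpha(k)=\varkappa-A_\alpha(k)$, where $(Vf)_x=V_xf_x$, $(\varkappa f)_x=\varkappa_xf_x$, $(A_\alpha(k)f)_x=\sum_{\mathbf e=(x,y)\in\mathcal A_*}e^{i(\alpha(\mathbf e)+\langle\tau(\mathbf e),k\rangle)}f_y$; its eigenvalues are $\lambda_{\alpha,1}(k)\le\dots\le\lambda_{\alpha,\nu}(k)$. Cycles: a path is a sequence of oriented edges $(\mathbf e_1,\dots,\mathbf e_n)$ with $\mathbf e_s=(x_{s-1},x_s)$; it is a cycle if $x_n=x_0$, of length $|\mathbf c|=n$. Cycles are ordered edge sequences (distinct cyclic shifts are distinct cycles) and backtracking cycles are included. For a cycle $\mathbf c$: index $\tau(\mathbf c)=\sum_{\mathbf e\in\mathbf c}\tau(\mathbf e)\in\mathbb Z^d$, flux $\alpha(\mathbf c)=(\sum_{\mathbf e\in\mathbf c}\alpha(\mathbf e))\bmod 2\pi$. Modified fundamental graph $\widetilde{\mathcal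 G}_*$: add at each $x\in\mathcal V_*$ one extra oriented loop $\mathbf e_x$ (a single oriented edge, $\underline{\mathbf e_x}=\mathbf e_x$) with $\tau(\mathbf e_x)=0$, $\alpha(\mathbf e_x)=0$. Weights: $\omega(\mathbf e)=1$ for $\mathbf e\in\mathcal A_*$, $\omega(\mathbf e_x)=v_x:=V_x-\varkappa_x$; for a cycle $\mathbf c=(\mathbf e_1,\dots,\mathbf e_n)$ of $\widetilde{\mathcal G}_*$, $\omega(\mathbf c)=\omega(\mathbf e_1)\cdots\omega(\mathbf e_n)$. $\widetilde{\mathcal C}_n$ is the set of cycles of length $n$ in $\widetilde{\mathcal G}_*$ and $\widetilde{\mathcal C}_n^{\mathrm m}$ the subset of those with index $\mathrm m\in\mathbb Z^d$. *)

(* Defs.v *)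
From HB Require Import structures.
From mathcomp Require Import all_boot all_order all_algebra.
From mathcomp Require Import all_classical all_reals.
From mathcomp Require Import topology normedtype sequences trigo measure
  lebesgue_measure lebesgue_integral.
From mathcomp Require Import complex.
Set Implicit Arguments. Unset Strict Implicit. Unset Printing Implicit Defensive.
Import Order.TTheory GRing.Theory Num.Theory.
Local Open Scope ring_scope.
Local Open Scope complex_scope.

Record fund_graph (nu d : nat) := FGraph {
  fg_A : finType;
  fg_src : fg_A -> 'I_nu;
  fg_tgt : fg_A -> 'I_nu;
  fg_inv : fg_A -> fg_A;
  fg_tau : fg_A -> 'rV[int]_d
}.

Arguments fg_A {nu d} G : rename.
Arguments fg_src {nu d} G e : rename.
Arguments fg_tgt {nu d} G e : rename.
Arguments fg_inv {nu d} G e : rename.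
Arguments fg_tau {nu d} G e : rename.

Definition fund_graph_wf nu d (G : fund_graph nu d) : Prop :=
  [/\ forall e, fg_inv G (fg_inv G e) = e,
      forall e, fg_inv G e <> e,
      forall e, fg_src G (fg_inv G e) = fg_tgt G e,
      forall e, fg_tgt G (fg_inv G e) = fg_src G e &
      forall e, fg_tau G (fg_inv G e) = - fg_tau G e].

(* The periodic graph G: vertices (x, m) in V_* x Z^d; each oriented edge  *)
(* e of A_star gives edges (src e, m) -> (tgt e, m + tau e), m in Z^d.         *)
Inductive preach nu d (G : fund_graph nu d) (p : 'I_nu * 'rV[int]_d) :
    'I_nu * 'rV[int]_d -> Prop :=
  | preach_refl : preach G p p
  | preach_step q e : preach G p q -> fg_src G e = q.1 ->
      preach G p (fg_tgt G e, q.2 + fg_tau G e).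

Definition periodic_connected nu d (G : fund_graph nu d) : Prop :=
  forall p q, preach G p q.

Definition magnetic (R : realType) nu d (G : fund_graph nu d) (alpha : fg_A G -> R) : Prop :=
  forall e, alpha (fg_inv G e) = - alpha e.

Section Fiber.
Variables (R : realType) (nu d : nat) (G : fund_graph nu d).
Variables (alpha : fg_A G -> R) (V : 'I_nu -> R).

Local Notation A := (fg_A G).

Definition degree (x : 'I_nu) : nat := #|[set e : A | fg_src G e == x]|.

Definition dotk (m : 'rV[int]_d) (k : 'I_d -> R) : R :=
  \sum_(s < d) (m ord0 s)%:~R * k s.

Definition expi (t : R) : R[i] := (cos t) +i* (sin t).

Definition adjk (k : 'I_d -> R) : 'M[R[i]]_nu :=
  \matrix_(x, y) \sum_(e : A | (fg_src G e == x) && (fg_tgt G e == y))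
     expi (alpha e + dotk (fg_tau G e) k).

Definition laplk (k : 'I_d -> R) : 'M[R[i]]_nu :=
  \matrix_(x, y) (((x == y)%:R * ((degree x)%:R)%:C) - adjk k x y).

Definition fiberH (k : 'I_d -> R) : 'M[R[i]]_nu :=
  - laplk k + diag_mx (\row_x (V x)%:C).

(* Modified fundamental graph: oriented edges A_star + one extra loop per vertex *)
Definition tA := (A + 'I_nu)%type.

Definition tsrc (e : tA) : 'I_nu :=
  match e with inl e => fg_src G e | inr x => x end.
Definition ttgt (e : tA) : 'I_nu :=
  match e with inl e => fg_tgt G e | inr x => x end.
Definition ttau (e : tA) : 'rV[int]_d :=
  match e with inl e => fg_tau G e | inr _ => 0 end.
Definition talpha (e : tA) : R :=
  match e with inl e => alpha e | inr _ => 0 end.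
Definition weight (e : tA) : R :=
  match e with inl _ => 1 | inr x => V x - (degree x)%:R end.

Definition is_cycle n (c : n.-tuple tA) : bool :=
  [forall i : 'I_n, ttgt (tnth c i) == tsrc (tnth c (ordS i))].

Definition omega n (c : n.-tuple tA) : R := \prod_(i < n) weight (tnth c i).
Definition ctau n (c : n.-tuple tA) : 'rV[int]_d := \sum_(i < n) ttau (tnth c i).
Definition calpha n (c : n.-tuple tA) : R := \sum_(i < n) talpha (tnth c i).
Definition cphi n (c : n.-tuple tA) (k : 'I_d -> R) : R :=
  calpha c + dotk (ctau c) k.

Definition Tr_exp n (k : 'I_d -> R) : R[i] :=
  \sum_(c : n.-tuple tA | is_cycle c) (omega c)%:C * expi (- cphi c k).
Definition Tr_cos n (k : 'I_d -> R) : R :=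
  \sum_(c : n.-tuple tA | is_cycle c) omega c * cos (cphi c k).

Definition Tcoef n (m : 'rV[int]_d) : R[i] :=
  \sum_(c : n.-tuple tA | is_cycle c && (ctau c == m))
     (omega c)%:C * expi (- calpha c).
Definition Tcoef_cos n (m : 'rV[int]_d) : R :=
  \sum_(c : n.-tuple tA | is_cycle c && (ctau c == m))
     omega c * cos (calpha c).

Definition inorm (m : 'rV[int]_d) : R :=
  Num.sqrt (\sum_(s < d) ((m ord0 s)%:~R) ^+ 2).
Definition tau_plus : R := \big[Num.max/0]_(e : A) inorm (fg_tau G e).

(* The finite set {m in Z^d : ||m|| <= n tau_+} is enumerated inside the
   integer box [-B, B]^d, where B := n * sum_e sum_s |tau e s| bounds every
   coordinate of such m (since tau_+ <= sum_e sum_s |tau e s|). *)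
Definition boxB n : nat := (n * \sum_(e : A) \sum_(s < d) `|fg_tau G e ord0 s|%N)%N.
Definition box_pt n (f : {ffun 'I_d -> 'I_((boxB n).*2.+1)}) : 'rV[int]_d :=
  \row_s ((f s : nat)%:Z - (boxB n)%:Z).

Definition sum_ball n (F : 'rV[int]_d -> R[i]) : R[i] :=
  \sum_(f : {ffun 'I_d -> 'I_((boxB n).*2.+1)} |
          inorm (box_pt f) <= n%:R * tau_plus) F (box_pt f).

Definition Tr_fourier n (k : 'I_d -> R) : R[i] :=
  sum_ball n (fun m => Tcoef n m * expi (- dotk m k)).

End Fiber.

(* Integral over the torus T^d = [0, 2 pi]^d, as an iterated Lebesgue
   integral (coordinate 0 outermost). *)
Fixpoint iter_int (R : realType) (d : nat) (f : seq R -> R) : R :=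
  match d with
  | 0 => f [::]
  | d'.+1 => Rintegral (@lebesgue_measure R) `[0, pi *+ 2]%classic
               (fun t => iter_int d' (fun l => f (t :: l)))
  end.

Definition torus_int (R : realType) (d : nat) (F : ('I_d -> R) -> R[i]) : R[i] :=
  (iter_int d (fun l => complex.Re (F (fun s => nth 0 l s))))
  +i* (iter_int d (fun l => complex.Im (F (fun s => nth 0 l s)))).

(* Main.v *)
(** Expanding the n-th power of the fiber matrix over walks gives
    Tr H^n(k) = sum of omega(c) e^{i phi(c,k)} over the cycles of length n.
    Reversing a cycle preserves its weight and negates its phase, so the sum is
    real and the sign in the exponent is immaterial. Sorting the cycles by index
    gives the Fourier series: only indices in the ball of radius n tau_+ occur.
    Integrating the cosine form one variable at a time over a full period kills
    every cycle of nonzero index. The eigenvalue formula is Schur's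
    triangularization. *)
Require Import Defs.
From HB Require Import structures.
From mathcomp Require Import all_boot all_order all_algebra.
From mathcomp Require Import all_classical all_reals.
From mathcomp Require Import topology normedtype sequences trigo measure
  lebesgue_measure lebesgue_integral.
From mathcomp Require Import derive realfun ftc.
From mathcomp Require Import complex zify lra.
Import Order.TTheory GRing.Theory Num.Theory.
Import numFieldNormedType.Exports.
Local Open Scope ring_scope.
Local Open Scope complex_scope.

(** * Traces of matrix powers *)

(** Entries vanish for i < j. For i <= j each term of entry (i, j) of [A * A ^+ k] has such a
    vanishing factor, except the term l = i when i = j. *)
Lemma trig_mx_exp (C : comNzRingType) n (A : 'M[C]_n) k :
  is_trig_mx A ->
  is_trig_mx (A ^+ k) /\ forall i, (A ^+ k) i i = A i i ^+ k.
Proof.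
move=> /is_trig_mxP tA; elim: k => [|k [/is_trig_mxP tAk dAk]].
  split; last by move=> i; rewrite !expr0 mxE eqxx.
  by apply/is_trig_mxP => i j ij; rewrite expr0 mxE -val_eqE ltn_eqF.
split; last first.
  move=> i; rewrite !exprS mxE (bigD1 i) //= dAk big1 ?addr0 // => j.
  rewrite -val_eqE neq_ltn => /orP[ji|ij].
    by rewrite [X in _ * X]tAk ?mulr0.
  by rewrite [X in X * _]tA ?mul0r.
apply/is_trig_mxP => i j ij; rewrite exprS mxE big1 // => l _.
have [il|li] := ltnP i l; first by rewrite [X in X * _]tA ?mul0r.
by rewrite [X in _ * X]tAk ?mulr0 //; apply: leq_ltn_trans ij.
Qed.

(** Conjugation by [P] carries over to the characteristic matrix, where the determinants of [P] and
    its inverse cancel. *)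
Lemma char_poly_conj (C : fieldType) n (P A : 'M[C]_n) :
  P \in unitmx -> char_poly (P *m A *m invmx P) = char_poly A.
Proof.
move=> uP; rewrite /char_poly.
have -> : char_poly_mx (P *m A *m invmx P)
    = map_mx polyC P *m char_poly_mx A *m map_mx polyC (invmx P).
  rewrite /char_poly_mx mulmxBr mulmxBl !map_mxM; congr (_ - _).
  by rewrite scalar_mxC -mulmxA -map_mxM mulmxV // map_mx1 mulmx1.
rewrite !det_mulmx mulrAC -det_mulmx -map_mxM mulmxV // map_mx1 det1.
by rewrite mul1r.
Qed.

(** Schur gives a triangular matrix [B] similar to [A]. Unique factorization of the characteristic
    polynomial makes the [l j] a permutation of the diagonal of [B], so the power sums agree. *)
Lemma mxtrace_exp_char_poly (C : numClosedFieldType) n (A : 'M[C]_n)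
    (l : 'I_n -> C) k :
  char_poly A = \prod_(j < n) ('X - (l j)%:P) ->
  \tr (A ^+ k) = \sum_(j < n) l j ^+ k.
Proof.
case: n A l => [|n] A l cA; first by rewrite /mxtrace !big_ord0.
have [P /unitarymx_unit uP] := Schur A isT.
rewrite /similar_to; set B := conjmx P A => tB.
have defB : B = P *m A *m invmx P by rewrite /B conjumx.
have powB : B ^+ k = P *m A ^+ k *m invmx P.
  elim: k => [|k IH]; first by rewrite !expr0 mulmx1 mulmxV.
  by rewrite exprS IH defB -mulmxE !mulmxA mulmxKV // exprS -mulmxE !mulmxA.
have -> : \tr (A ^+ k) = \tr (B ^+ k).
  by rewrite powB mxtrace_mulC mulmxA mulVmx // mul1mx.
have := char_poly_trig tB; rewrite defB char_poly_conj // -defB cA.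
rewrite -[LHS](big_map l xpredT (fun x => 'X - x%:P)).
rewrite -[RHS](big_map (fun i => B i i) xpredT (fun x => 'X - x%:P)).
move=> /prod_XsubC_eq perm_lB.
rewrite /mxtrace; under eq_bigr do rewrite (trig_mx_exp _ _ _ _ tB).2.
rewrite -[RHS](big_map l xpredT (fun x => x ^+ k)) (perm_big _ perm_lB) /=.
by rewrite big_map.
Qed.

(** * Matrix powers as weighted sums over walks *)

Section Walks.
Variables (C : comNzRingType) (nu : nat) (E : finType).
Variables (src tgt : E -> 'I_nu).

(** Both endpoints are kept free, so that peeling off the first edge matches the row expansion of a
    matrix product. *)
Fixpoint walk x (s : seq E) y : bool :=
  if s is e :: s' then (src e == x) && walk (tgt e) s' y else x == y.

(** The base point is separated from the cyclic condition, so that summing over [x] selects a single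
    vertex. *)
Lemma walk_cycle n (c : n.+1.-tuple E) x :
  walk x c x = (src (thead c) == x) && cycle (fun e f => tgt e == src f) c.
Proof.
case/tupleP: c => e s; rewrite theadE /=.
case: eqP => //= <-.
have: forall f (r : seq E), walk (tgt f) r (src e)
  = path (fun e f => tgt e == src f) f (rcons r e).
  by move=> f r; elim: r f => [|g r IH] f /=; rewrite ?andbT // IH eq_sym.
exact.
Qed.

(** Passes from indices to lists, where reversal and mapping of cycles are easy to handle. *)
Lemma is_cycle_tnthE n (c : n.-tuple E) :
  [forall i : 'I_n, tgt (tnth c i) == src (tnth c (ordS i))]
  = cycle (fun e f => tgt e == src f) c.
Proof.
case: n c => [|n] c.
  by rewrite tuple0; apply/forallP => -[].
case/tupleP: c => e s; rewrite /=.
apply/forallP/(pathP e) => [H i|H i].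
  rewrite size_rcons size_tuple => lti; have := H (Ordinal lti).
  rewrite !(tnth_nth e) /= nth_rcons size_tuple.
  have -> : nth e (e :: rcons s e) i = nth e (e :: s) i.
    by rewrite -rcons_cons nth_rcons /= size_tuple lti.
  (* At the last index i = n, [ordS] wraps around to the first edge. *)
  move: lti; rewrite ltnS leq_eqVlt => /orP[/eqP->|lti].
    by rewrite modnn ltnn eqxx.
  by rewrite modn_small ?ltnS // lti.
have lti' : (i < size (rcons s e))%N by rewrite size_rcons size_tuple.
have := H i lti' => {H lti'}.
rewrite !(tnth_nth e) /= -rcons_cons !nth_rcons /= size_tuple ltn_ord.
have : (i <= n)%N by rewrite -ltnS.
rewrite leq_eqVlt => /orP[/eqP->|lti].
  by rewrite modnn ltnn eqxx.
by rewrite modn_small ?ltnS // lti.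
Qed.

Lemma big_tuple_consE n (P : pred (seq E)) (F : seq E -> C) :
  \sum_(c : n.+1.-tuple E | P c) F c =
  \sum_e \sum_(c : n.-tuple E | P (e :: c)) F (e :: c).
Proof.
rewrite pair_big_dep /=.
rewrite (reindex (fun p : E * n.-tuple E => [tuple of p.1 :: p.2])) //=.
exists (fun c => (thead c, [tuple of behead c])) => [[e c]|c] _ /=.
  rewrite theadE; congr pair; exact: val_inj.
by rewrite -tuple_eta.
Qed.

(** Induction on the first edge: the intermediate vertex of the matrix product is forced to be its
    target. *)
Lemma walk_sum_exp (w : E -> C) (M : 'M[C]_nu) n x y :
  (forall x y, M x y = \sum_(e | (src e == x) && (tgt e == y)) w e) ->
  (M ^+ n) x y = \sum_(c : n.-tuple E | walk x c y) \prod_(e <- c) w e.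
Proof.
move=> defM; elim: n x => [|n IH] x.
  rewrite expr0 mxE; have [->|neq] := eqVneq x y.
    rewrite (big_pred1 [tuple]) ?big_nil // => c.
    by rewrite (tuple0 c) /= !eqxx.
  by rewrite big_pred0 // => c; rewrite (tuple0 c) /= (negPf neq).
rewrite exprS mxE.
rewrite (big_tuple_consE _ (fun s => walk x s y) (fun s => \prod_(e <- s) w e)).
transitivity (\sum_z \sum_(e | (src e == x) && (tgt e == z))
    w e * \sum_(c : n.-tuple E | walk (tgt e) c y) \prod_(e' <- c) w e').
  apply: eq_bigr => z _; rewrite defM mulr_suml.
  by apply: eq_bigr => e /andP[_ /eqP <-]; rewrite IH.
rewrite (exchange_big_dep (fun e => src e == x)); last first.
  by move=> z e _ /andP[].
rewrite [RHS](bigID (fun e => src e == x)) /=.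
rewrite [X in _ = _ + X]big1 ?addr0; last first.
  by move=> e /negPf sx; rewrite big_pred0 // => c; rewrite sx.
apply: eq_bigr => e ->; rewrite (big_pred1 (tgt e)); last first.
  by move=> z; rewrite eq_sym.
by rewrite mulr_sumr; apply: eq_bigr => c _; rewrite big_cons.
Qed.

(** The exponent is positive because in length 0 the empty tuple would contribute 1, while the trace
    of the identity is [nu]. A nonempty cycle has exactly one base point, the source of its first
    edge. *)
Lemma mxtrace_exp_cycles (w : E -> C) (M : 'M[C]_nu) n :
  (forall x y, M x y = \sum_(e | (src e == x) && (tgt e == y)) w e) ->
  \tr (M ^+ n.+1) =
  \sum_(c : n.+1.-tuple E
        | [forall i, tgt (tnth c i) == src (tnth c (ordS i))])
    \prod_(i < n.+1) w (tnth c i).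
Proof.
move=> defM; rewrite /mxtrace.
under eq_bigr do rewrite (walk_sum_exp w) //.
rewrite (exchange_big_dep predT) //= [RHS]big_mkcond /=.
apply: eq_bigr => c _; rewrite is_cycle_tnthE.
under eq_bigl do rewrite walk_cycle.
case: (cycle _ c); last by rewrite big_pred0 // => x; rewrite andbF.
rewrite (big_pred1 (src (thead c))); first by rewrite big_tuple.
by move=> x; rewrite andbT eq_sym.
Qed.

End Walks.

(** * Integrals of trigonometric sums over the torus *)

Lemma sin_shift_int (R : realType) (a : R) (m : int) :
  sin (a + m%:~R * (pi *+ 2)) = sin a.
Proof.
case: m => n.
  by rewrite -pmulrn mulr_natl (periodicn (@sinD2pi R)).
rewrite NegzE mulrNz mulNr -pmulrn mulr_natl.
by rewrite -[in RHS](subrK (pi *+ 2 *+ n.+1) a) (periodicn (@sinD2pi R)).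
Qed.

Lemma continuous_cos_affine (R : realType) (a m : R) :
  continuous (fun t : R => cos (a + m * t)).
Proof.
move=> t; apply: (@continuous_comp _ _ _ (fun t : R => a + m * t) cos).
  by apply: cvgD; [exact: cvg_cst|apply: cvgM; [exact: cvg_cst|exact: cvg_id]].
exact: continuous_cos.
Qed.

Lemma integral_cos_affine (R : realType) (a : R) (m : int) :
  (\int[@lebesgue_measure R]_(t in `[0%R, (pi *+ 2)%R])
     (cos (a + m%:~R * t))%:E)%E
  = ((if m == 0 then pi *+ 2 * cos a else 0)%:E)%E.
Proof.
(* A primitive of the integrand; for m <> 0 it takes equal values at 0 and 2 pi. *)
pose F (t : R) := if m == 0 then t * cos a
                  else (m%:~R)^-1 * sin (a + m%:~R * t).
have dF (t : R) : is_derive t (1 : R) F (cos (a + m%:~R * t)).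
  rewrite /F; have [->|m0] := eqVneq m 0.
    rewrite mul0r addr0; apply: is_derive_eq.
    by rewrite scaler0 add0r /GRing.scale /= mulr1.
  have -> : cos (a + m%:~R * t) = (m%:~R)^-1 *: (m%:~R *: cos (a + m%:~R * t)).
    by rewrite scalerA mulVf ?scale1r // intr_eq0.
  apply: is_deriveZ.
  rewrite /GRing.scale /= mulrC.
  apply: (@is_derive1_comp R sin (fun t : R => a + m%:~R * t)).
  by apply: is_derive_eq; rewrite /GRing.scale /= add0r mul1r mulr1.
have cF : continuous F.
  move=> t; apply: differentiable_continuous; apply/derivable1_diffP.
  by case: (dF t).
rewrite (@continuous_FTC2 R _ F).
- rewrite /F; case: eqP => _; rewrite ?mul0r ?sube0 //.
  by rewrite -EFinB -mulrBr mulr0 addr0 sin_shift_int subrr mulr0.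
- by rewrite pmulrn_lgt0 // pi_gt0.
- by apply: continuous_subspaceT => t; exact: continuous_cos_affine.
- split.
  + by move=> t _; case: (dF t).
  + by apply: cvg_at_right_filter; exact: cF.
  + by apply: cvg_at_left_filter; exact: cF.
- by move=> t _; rewrite derive1E; case: (dF t).
Qed.

Lemma Rintegral_trig_sum (R : realType) (I : finType) (P : pred I)
    (w a : I -> R) (m : I -> int) :
  Rintegral (@lebesgue_measure R) `[0, pi *+ 2]%classic
    (fun t => \sum_(i | P i) w i * cos (a i + (m i)%:~R * t))
  = pi *+ 2 * \sum_(i | P i && (m i == 0)) w i * cos (a i).
Proof.
have intc i : (@lebesgue_measure R).-integrable `[0, pi *+ 2]%classic
    (fun t => (cos (a i + (m i)%:~R * t))%:E).
  apply: continuous_compact_integrable; first exact: segment_compact.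
  by apply: continuous_subspaceT => t; exact: continuous_cos_affine.
rewrite /Rintegral.
under eq_integral do rewrite -sumEFin.
have intwc i : (@lebesgue_measure R).-integrable `[0, pi *+ 2]%classic
    (fun t => (w i * cos (a i + (m i)%:~R * t))%:E).
  exact: (integrableZl _ (w i) (intc i)).
rewrite integral_sum //= (eq_bigr (fun i =>
    (pi *+ 2 * (if m i == 0 then w i * cos (a i) else 0))%:E)); last first.
  move=> i _; under eq_integral do rewrite EFinM.
  rewrite integralZl // integral_cos_affine -EFinM.
  by case: eqP => _; rewrite ?mulr0 // mulrCA.
by rewrite sumEFin /= -mulr_sumr -big_mkcondr.
Qed.

Lemma iter_int0 (R : realType) d : iter_int d (fun _ : seq R => 0 : R) = 0.
Proof.
elim: d => //= d IH; under eq_Rintegral do rewrite IH.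
by rewrite Rintegral_cst // mul0r.
Qed.

(** Frequencies are indexed by [nat] so that they can be shifted in the induction on [d]. For a
    fixed outer variable t, the term m_0 t is absorbed into the phase [a]. *)
Lemma iter_int_trig_sum (R : realType) d (I : finType) (P : pred I)
    (w a : I -> R) (m : I -> nat -> int) :
  iter_int d (fun l =>
    \sum_(i | P i) w i * cos (a i + \sum_(s < d) (m i s)%:~R * nth 0 l s))
  = (pi *+ 2) ^+ d *
    \sum_(i | P i && [forall s : 'I_d, m i s == 0]) w i * cos (a i).
Proof.
elim: d P w a m => [|d IH] P w a m /=.
  rewrite expr0 mul1r; apply: eq_big => [i|i _]; last by rewrite big_ord0 addr0.
  by rewrite (_ : [forall s : 'I_0, _]) ?andbT //; apply/forallP => -[].
transitivity (Rintegral (@lebesgue_measure R) `[0, pi *+ 2]%classic (fun t =>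
  \sum_(i | P i && [forall s : 'I_d, m i s.+1 == 0])
     ((pi *+ 2) ^+ d * w i) * cos (a i + (m i 0%N)%:~R * t))).
  apply: eq_Rintegral => t _.
  under [RHS]eq_bigr do rewrite -mulrA.
  rewrite -mulr_sumr.
  rewrite -(IH P w (fun i => a i + (m i 0%N)%:~R * t) (fun i s => m i s.+1)).
  congr (iter_int d _); apply/funext => l.
  by apply: eq_bigr => i _; rewrite big_ord_recl /= addrA.
rewrite Rintegral_trig_sum exprS -mulrA [X in _ = _ * X]mulr_sumr.
congr (_ * _).
apply: eq_big => [i|i _]; last by rewrite mulrA.
rewrite -andbA; congr (_ && _); apply/andP/forallP => [[/forallP h h0] s|h].
  by case: (unliftP ord0 s) => [j ->|->] //; exact: h.
by split; [apply/forallP => s; exact: (h (lift ord0 s))|exact: (h ord0)].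
Qed.

(** * Cycles of the modified fundamental graph *)

Lemma expiD (R : realType) (s t : R) : expi (s + t) = expi s * expi t.
Proof.
rewrite /expi cosD sinD; apply/eqP.
by rewrite eq_complex /= [_ + cos s * _]addrC !eqxx.
Qed.

Lemma expi0 (R : realType) : expi (0 : R) = 1.
Proof. by rewrite /expi cos0 sin0. Qed.

Lemma dotkD (R : realType) d (m m' : 'rV[int]_d) (k : 'I_d -> R) :
  dotk (m + m') k = dotk m k + dotk m' k.
Proof.
by rewrite -big_split; apply: eq_bigr => s _; rewrite mxE intrD mulrDl.
Qed.

Lemma dotk0 (R : realType) d (k : 'I_d -> R) : dotk 0 k = 0.
Proof. by rewrite /dotk big1 // => s _; rewrite mxE mul0r. Qed.

Lemma dotkN (R : realType) d (m : 'rV[int]_d) (k : 'I_d -> R) :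
  dotk (- m) k = - dotk m k.
Proof. by rewrite -sumrN; apply: eq_bigr => s _; rewrite mxE intrN mulNr. Qed.

Section Trace.
Variables (R : realType) (nu d : nat) (G : fund_graph nu d).
Variables (alpha : fg_A G -> R) (V : 'I_nu -> R).

(** The extra loops, with phase 0 and weight V - degree, account for the diagonal part, which makes
    the fiber matrix a weighted adjacency matrix of the modified graph. *)
Lemma fiberH_entry (k : 'I_d -> R) x y :
  fiberH alpha V k x y = \sum_(e : tA G | (tsrc e == x) && (ttgt e == y))
    (weight V e)%:C * expi (talpha alpha e + dotk (ttau e) k).
Proof.
rewrite /fiberH /laplk !mxE big_sumType /= opprB.
rewrite -addrA; congr (_ + _).
  by apply: eq_bigr => e _; rewrite mul1r.
rewrite (eq_bigr (fun z => (V z)%:C - ((degree G z)%:R)%:C)); last first.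
  by move=> z _; rewrite dotk0 addr0 expi0 mulr1 rmorphB.
have [->|xy] := eqVneq x y.
  rewrite (big_pred1 y) => [|z]; last by rewrite andbb.
  by rewrite mulr1n mul1r addrC.
rewrite mulr0n mul0r oppr0 addr0 big_pred0 // => z.
by apply/negP => /andP[/eqP-> /eqP eqxy]; rewrite eqxy eqxx in xy.
Qed.

Lemma mxtrace_fiberH (k : 'I_d -> R) n :
  \tr (fiberH alpha V k ^+ n.+1) = \sum_(c : n.+1.-tuple (tA G) | is_cycle c)
    (omega V c)%:C * expi (cphi alpha c k).
Proof.
rewrite (mxtrace_exp_cycles _ _ _ _ _ _ _ _ (fiberH_entry k)).
apply: eq_bigr => c _; rewrite big_split /=; congr (_ * _).
  by rewrite /omega rmorph_prod.
rewrite /cphi /calpha /ctau.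
rewrite (big_morph (fun m => dotk m k) (fun m m' => dotkD _ _ m m' k)
  (dotk0 _ _ k)).
by rewrite -big_split (big_morph _ (@expiD R) (@expi0 R)).
Qed.

(** * Reversal of cycles and reality of the cycle sums *)

Definition tinv (e : tA G) : tA G :=
  match e with inl e => inl (fg_inv G e) | inr x => inr x end.

Definition trev {n} (c : n.-tuple (tA G)) : n.-tuple (tA G) :=
  [tuple of rev (map tinv c)].

Lemma big_trev (S : Type) (idx : S) (op : Monoid.com_law idx) n
    (c : n.-tuple (tA G)) (F : tA G -> S) :
  \big[op/idx]_(i < n) F (tnth (trev c) i) =
  \big[op/idx]_(i < n) F (tinv (tnth c i)).
Proof.
rewrite -(big_tuple _ _ (trev c) xpredT) /= (perm_big _ (permEl (perm_rev _))).
by rewrite big_map big_tuple.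
Qed.

Hypothesis wfG : fund_graph_wf G.

Lemma trevK n : involutive (@trev n).
Proof.
move=> c; apply: val_inj; rewrite /= map_rev revK -map_comp.
apply: map_id_in => -[e|x] _ //=; by case: wfG => ->.
Qed.

Lemma is_cycle_trev n (c : n.-tuple (tA G)) : is_cycle (trev c) = is_cycle c.
Proof.
rewrite /is_cycle !is_cycle_tnthE /= rev_cycle cycle_map; apply: eq_cycle.
case: wfG => _ _ srcI tgtI _ e f; rewrite eq_sym.
by case: e f => [e|x] [f|y] /=; rewrite ?srcI ?tgtI.
Qed.

Lemma omega_trev n (c : n.-tuple (tA G)) : omega V (trev c) = omega V c.
Proof. by rewrite /omega big_trev; apply: eq_bigr => i _; case: (tnth c i). Qed.

Lemma ctau_trev n (c : n.-tuple (tA G)) : ctau (trev c) = - ctau c.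
Proof.
rewrite /ctau big_trev -sumrN; apply: eq_bigr => i _.
by case: wfG => _ _ _ _ tauI; case: (tnth c i) => //= _; rewrite oppr0.
Qed.

Hypothesis alphaI : magnetic alpha.

Lemma calpha_trev n (c : n.-tuple (tA G)) :
  calpha alpha (trev c) = - calpha alpha c.
Proof.
rewrite /calpha big_trev -sumrN; apply: eq_bigr => i _.
by case: (tnth c i) => //= _; rewrite oppr0.
Qed.

Lemma cphi_trev n (c : n.-tuple (tA G)) k :
  cphi alpha (trev c) k = - cphi alpha c k.
Proof. by rewrite /cphi calpha_trev ctau_trev dotkN opprD. Qed.

(** Reindexing by the involution [trev] turns the sine sum into its own negative, so it vanishes and
    only the cosines remain. *)
Lemma sum_expi_real n (P : pred (n.-tuple (tA G))) (f : n.-tuple (tA G) -> R) :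
  (forall c, P (trev c) = P c) -> (forall c, f (trev c) = - f c) ->
  \sum_(c | P c) (omega V c)%:C * expi (f c) =
  (\sum_(c | P c) omega V c * cos (f c))%:C.
Proof.
move=> Ptrev ftrev.
have sin0 : \sum_(c | P c) omega V c * sin (f c) = 0.
  apply/eqP; rewrite -eqNr -sumrN; apply/eqP.
  rewrite [RHS](reindex_inj (inv_inj (@trevK n))) /=.
  by apply: eq_big => c *; rewrite ?Ptrev // omega_trev ftrev sinN mulrN.
rewrite (eq_bigr (fun c => (omega V c * cos (f c))%:C
                  + (0 +i* 1) * (omega V c * sin (f c))%:C)); last first.
  move=> c _; rewrite /expi; apply/eqP; rewrite eq_complex /=.
  by rewrite !mul0r !mul1r ?mulr0 !subr0 !addr0 !add0r !eqxx.
by rewrite big_split /= -mulr_sumr -!rmorph_sum sin0 rmorph0 mulr0 addr0.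
Qed.

Lemma Tr_exp_cos n k : Tr_exp alpha V n k = (Tr_cos alpha V n k)%:C.
Proof.
rewrite /Tr_exp (sum_expi_real _ (@is_cycle _ _ _ n)
  (fun c => - cphi alpha c k)).
- by under eq_bigr do rewrite cosN.
- exact: is_cycle_trev.
- by move=> c; rewrite cphi_trev.
Qed.

(** The matrix expansion has phase +phi and [Tr_exp] has -phi; as cosine is even, both reduce to the
    same real sum. *)
Lemma mxtrace_fiberH_cos n k :
  \tr (fiberH alpha V k ^+ n.+1) = (Tr_cos alpha V n.+1 k)%:C.
Proof.
rewrite mxtrace_fiberH (sum_expi_real _ (@is_cycle _ _ _ n.+1)) // => c.
- exact: is_cycle_trev.
- exact: cphi_trev.
Qed.

(** Reversal carries cycles of index m to cycles of index -m, so it preserves the class m = 0. *)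
Lemma Tcoef0_cos n : Tcoef alpha V n 0 = (Tcoef_cos alpha V n 0)%:C.
Proof.
rewrite /Tcoef (sum_expi_real _ (fun c => is_cycle c && (ctau c == 0))
  (fun c => - calpha alpha c)).
- by under eq_bigr do rewrite cosN.
- by move=> c; rewrite is_cycle_trev ctau_trev oppr_eq0.
- by move=> c; rewrite calpha_trev.
Qed.

End Trace.

(** * Bounds on cycle indices and the Fourier series *)

Section Ball.
Variables (R : realType) (nu d : nat) (G : fund_graph nu d).

(** Cauchy-Schwarz against the all-ones vector, summed from a_i a_j <= (a_i^2 + a_j^2) / 2. *)
Lemma sqr_sum_le n (a : 'I_n -> R) :
  (\sum_i a i) ^+ 2 <= n%:R * \sum_i a i ^+ 2.
Proof.
have -> : n%:R * \sum_i a i ^+ 2 = \sum_i \sum_j (a i ^+ 2 + a j ^+ 2) / 2.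
  rewrite [RHS](eq_bigr (fun i => (n%:R * a i ^+ 2 + \sum_j a j ^+ 2) / 2)).
    rewrite -mulr_suml big_split /= -mulr_sumr sumr_const card_ord.
    by rewrite -[X in _ + X]mulr_natl; lra.
  move=> i _; rewrite -mulr_suml big_split /= sumr_const card_ord.
  by rewrite mulr_natl.
rewrite expr2 mulr_suml; apply: ler_sum => i _.
rewrite mulr_sumr; apply: ler_sum => j _.
by have := sqr_ge0 (a i - a j); rewrite sqrrB; lra.
Qed.

Lemma tau_plus_ge0 : 0 <= tau_plus R G.
Proof. exact: bigmax_ge_id. Qed.

Lemma inorm_ttau (e : tA G) : inorm R (ttau e) <= tau_plus R G.
Proof.
case: e => [e|x] /=; first exact: le_bigmax.
rewrite /inorm big1 ?sqrtr0 ?tau_plus_ge0 // => s _.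
by rewrite mxE expr0n.
Qed.

(** Cauchy-Schwarz in each coordinate bounds the squared norm by n times the sum of the squared edge
    norms, hence by n^2 tau_+^2. *)
Lemma inorm_ctau n (c : n.-tuple (tA G)) :
  inorm R (ctau c) <= n%:R * tau_plus R G.
Proof.
have h0 : 0 <= n%:R * tau_plus R G by rewrite mulr_ge0 // tau_plus_ge0.
rewrite /inorm -(ger0_norm h0) -sqrtr_sqr ler_wsqrtr //.
apply: (@le_trans _ _ (\sum_(s < d) n%:R *
    \sum_(i < n) ((ttau (tnth c i) ord0 s)%:~R : R) ^+ 2)).
  apply: ler_sum => s _; apply: le_trans (sqr_sum_le _ _).
  by rewrite summxE rmorph_sum.
rewrite -mulr_sumr exchange_big exprMn expr2 -mulrA /=.
apply: ler_wpM2l => //.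
rewrite mulr_natl -[n in leRHS]card_ord -sumr_const; apply: ler_sum => i _.
have -> : \sum_(s < d) ((ttau (tnth c i) ord0 s)%:~R : R) ^+ 2
    = inorm R (ttau (tnth c i)) ^+ 2.
  by rewrite sqr_sqrtr // sumr_ge0 // => s _; rewrite sqr_ge0.
by rewrite lerXn2r ?nnegrE ?sqrtr_ge0 ?tau_plus_ge0 // inorm_ttau.
Qed.

(** Each of the n edges contributes either 0 or a single term of the double sum in [boxB]. *)
Lemma ctau_coord_le n (c : n.-tuple (tA G)) s :
  (`|ctau c ord0 s| <= boxB G n)%N.
Proof.
rewrite /ctau summxE.
have : (`|(\sum_(i < n) ttau (tnth c i) ord0 s)%R| <=
        \sum_(i < n) `|ttau (tnth c i) ord0 s|%N)%N.
  elim/big_rec2: _ => // i m z _ h; apply: leq_trans (leq_add (leqnn _) h).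
  lia.
move=> /leq_trans; apply; rewrite /boxB -[n in leqRHS]card_ord -sum_nat_const.
apply: leq_sum => i _; case: (tnth c i) => [e|x] /=; last by rewrite mxE.
rewrite (bigD1 e) //= (bigD1 s) //= -addnA; exact: leq_addr.
Qed.

Lemma box_pt_inj n : injective (@box_pt _ _ G n).
Proof.
move=> f g fg; apply/ffunP => s; apply: val_inj.
by have /rowP/(_ s) := fg; rewrite !mxE => /addIr [].
Qed.

Lemma box_ptP n (m : 'rV[int]_d) : (forall s, `|m ord0 s| <= boxB G n)%N ->
  {f | box_pt (G := G) (n := n) f = m}.
Proof.
(* With B the box bound, m_s + B lies between 0 and 2B, so neither the absolute value nor [inord]
   alters it. *)
move=> hm; exists [ffun s => inord `|(m ord0 s + (boxB G n)%:Z)%R|%N].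
apply/rowP => s; rewrite mxE ffunE inordK; have := hm s.
all: by rewrite ?(ord1 ord0); lia.
Qed.

(** After exchanging the sums, each cycle meets exactly one box point, the one coding its index, and
    [inorm_ctau] puts this point in the ball. *)
Lemma Tr_exp_fourier (alpha : fg_A G -> R) (V : 'I_nu -> R) n k :
  Tr_exp alpha V n k = Tr_fourier alpha V n k.
Proof.
rewrite /Tr_fourier /sum_ball /Tcoef.
under [RHS]eq_bigr do rewrite mulr_suml.
rewrite (exchange_big_dep (@is_cycle _ _ _ n)) /=; last first.
  by move=> f c _ /andP[].
apply: eq_bigr => c cyc.
have [f fc] := box_ptP n (ctau c) (ctau_coord_le _ c).
rewrite (big_pred1 f).
  by rewrite fc -mulrA -expiD -opprD.
move=> g; rewrite cyc /= -fc (inj_eq (@box_pt_inj n)) eq_sym.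
by apply: andb_idl => /eqP ->; rewrite fc inorm_ctau.
Qed.

End Ball.

(** * Averaging the trace over the torus *)

Section Torus.
Variables (R : realType) (nu d : nat) (G : fund_graph nu d).
Variables (alpha : fg_A G -> R) (V : 'I_nu -> R).

Lemma torus_int_Tr_cos n :
  torus_int (fun k : 'I_d -> R => (Tr_cos alpha V n k)%:C) =
  ((pi *+ 2) ^+ d * Tcoef_cos alpha V n 0)%:C.
Proof.
rewrite /torus_int /= iter_int0; congr (_ +i* _).
(* The index coordinates extended by 0 beyond [d], the form required by [iter_int_trig_sum]. *)
pose m (c : n.-tuple (tA G)) (s : nat) : int :=
  if insub s is Some s' then ctau c ord0 s' else 0.
have mE c (s : 'I_d) : m c s = ctau c ord0 s by rewrite /m valK.
transitivity (iter_int d (fun l : seq R =>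
  \sum_(c : n.-tuple (tA G) | is_cycle c) omega V c *
    cos (calpha alpha c + \sum_(s < d) (m c s)%:~R * nth 0 l s))).
  congr iter_int; apply/funext => l; apply: eq_bigr => c _.
  by rewrite /cphi /dotk; under [in RHS]eq_bigr do rewrite mE.
rewrite iter_int_trig_sum; congr (_ * _); apply: eq_bigl => c; congr (_ && _).
apply/forallP/eqP => [h|c0 s]; last by rewrite mE c0 mxE.
by apply/rowP => s; rewrite mxE -mE; apply/eqP.
Qed.

End Torus.

Theorem theorem2p6 (R : realType) (nu d : nat) (G : fund_graph nu d)
    (alpha : fg_A G -> R) (V : 'I_nu -> R) :
  (0 < d)%N -> (0 < nu)%N ->
  fund_graph_wf G -> periodic_connected G -> magnetic alpha ->
  forall n : nat, (0 < n)%N ->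
  (* (i) *)
  (forall (k : 'I_d -> R) (lam : 'I_nu -> R),
     (forall i j : 'I_nu, (i <= j)%N -> lam i <= lam j) ->
     char_poly (fiberH alpha V k) = \prod_(j < nu) ('X - ((lam j)%:C)%:P) ->
     \tr (fiberH alpha V k ^+ n) = \sum_(j < nu) ((lam j) ^+ n)%:C) /\
  (forall k : 'I_d -> R,
     [/\ \tr (fiberH alpha V k ^+ n) = Tr_exp alpha V n k,
         Tr_exp alpha V n k = (Tr_cos alpha V n k)%:C &
         Tr_exp alpha V n k = Tr_fourier alpha V n k]) /\
  (* (ii) *)
  ((((pi *+ 2) ^+ d)^-1)%:C * torus_int (fun k => \tr (fiberH alpha V k ^+ n))
     = Tcoef alpha V n 0 /\
   Tcoef alpha V n 0 = (Tcoef_cos alpha V n 0)%:C).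
Proof.
move=> _ _ wfG _ alphaI [//|n] _; split; [|split; [|split]].
- move=> k lam _ /mxtrace_exp_char_poly ->.
  by apply: eq_bigr => j _; rewrite rmorphXn.
- move=> k; rewrite mxtrace_fiberH_cos // -Tr_exp_cos //; split=> //.
  exact: Tr_exp_fourier.
(* The real cosine form is integrated, and the factor (2 pi)^d cancels against the normalization. *)
- under eq_fun do rewrite mxtrace_fiberH_cos //.
  rewrite torus_int_Tr_cos Tcoef0_cos // -rmorphM mulKf // expf_neq0 //.
  by rewrite mulrn_eq0 /= gt_eqF ?pi_gt0.
- exact: Tcoef0_cos.
Qed.
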